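(* Let $R$ be a unital (Krasner) hyperring. Every maximal hyperideal of $R$ is a primitive hyperideal of $R$.
   Context: For a nonempty set $H$, $\mathcal P^*(H)$ is the set of nonempty subsets of $H$. A canonical hypergroup $(H,+,0)$ is a nonempty set $H$ with a hyperoperation $+\colon H\times H\to\mathcal P^*(H)$ and $0\in H$ (with $A+B=\bigcup_{a\in A,b\in B}(a+b)$ for subsets, and elements identified with singletons) such that for all $a,b,c\in H$: $a+b=b+a$; $a+(b+c)=(a+b)+c$; $a+0=\{a\}$; there is a unique $-a\in H$ with $0\in a-a:=a+(-a)$; and $a\in b+c$ implies $c\in -b+a$ and $b\in a-c$. A (Krasner) hyperring $R$ is a canonical hypergroup $(R,+,0)$ with an associative binary (single-valued) multiplication such that $a0=0a=0$, $a(b+c)=ab+ac$, $(a+b)c=ac+bc$; commutativity is not assumed. $R$ is unital if there is $1\in R$ with $a1=a=1a$ for all $a\in R$. A subhypergroup is a nonempty subset $S$ with $x-y\subseteq S$ for all $x,y\in S$. A hyperideal of $R$ is a subhypergroup $\mathfrak a$ with $ra\in\mathfrak a$ and $ar\in\mathfrak a$ for all $r\in R$, $a\in\mathfrak a$. A proper hyperideal $\mathfrak m$ is maximal if the only hyperideals of $R$ containing $\mathfrak m$ are $\mathfrak m$ and $R$. A (right) $R$-hypermodule is a canonical hypergroup $M$ with a map $M\times R\to M$, $(m,r)\mapsto mr$, such that $(m+m')r=mr+m'r$, $m(r+r')=mr+mr'$, $m(rr')=(mr)r'$, $m0=0$. A subhypermodule is a subhypergroup $S$ of $M$ with $sr\in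 S$ for all $s\in S$, $r\in R$. $M$ is simple if $MR\neq 0$ (i.e. $mr\ne0$ for some $m\in M,r\in R$) and its only subhypermodules are $0$ and $M$. $\mathtt{Ann}_R(M)=\{r\in R\mid mr=0\text{ for all }m\in M\}$. A proper hyperideal of $R$ is primitive if it equals $\mathtt{Ann}_R(M)$ for some simple $R$-hypermodule $M$. *)

(* Defs.v *)
From mathcomp Require Import all_boot.
From mathcomp Require Import classical_sets.

Set Implicit Arguments.
Unset Strict Implicit.
Unset Printing Implicit Defensive.

Local Open Scope classical_set_scope.

Definition set_hop (H : Type) (op : H -> H -> set H) (A B : set H) : set H :=
  \bigcup_(a in A) \bigcup_(b in B) op a b.

Record canonicalHypergroup := CanonicalHypergroup {
  ch_sort :> Type;
  hzero : ch_sort;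
  hadd : ch_sort -> ch_sort -> set ch_sort;
  hopp : ch_sort -> ch_sort;
  hadd_nonempty : forall a b, hadd a b !=set0;
  haddC : forall a b, hadd a b = hadd b a;
  haddA : forall a b c,
    set_hop hadd [set a] (hadd b c) = set_hop hadd (hadd a b) [set c];
  hadd0 : forall a, hadd a hzero = [set a];
  haddN : forall a, hadd a (hopp a) hzero;
  hopp_unique : forall a b, hadd a b hzero -> b = hopp a;
  hadd_reversible : forall a b c,
    hadd b c a -> hadd (hopp b) a c /\ hadd a (hopp c) b
}.

Arguments hzero {_}.
Arguments hadd {_} _ _.
Arguments hopp {_} _.

Definition is_subhypergroup (H : canonicalHypergroup) (S : set H) : Prop :=
  S !=set0 /\ (forall x y, S x -> S y -> hadd x (hopp y) `<=` S).

Record hyperring := Hyperring {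
  hr_hypergroup :> canonicalHypergroup;
  hmul : hr_hypergroup -> hr_hypergroup -> hr_hypergroup;
  hmulA : forall a b c, hmul a (hmul b c) = hmul (hmul a b) c;
  hmulr0 : forall a, hmul a hzero = hzero;
  hmul0r : forall a, hmul hzero a = hzero;
  hmulDr : forall a b c,
    [set hmul a x | x in hadd b c] = hadd (hmul a b) (hmul a c);
  hmulDl : forall a b c,
    [set hmul x c | x in hadd a b] = hadd (hmul a c) (hmul b c)
}.

Arguments hmul {_} _ _.

Definition unital (R : hyperring) : Prop :=
  exists e : R, forall a : R, hmul a e = a /\ hmul e a = a.

Definition is_hyperideal (R : hyperring) (I : set R) : Prop :=
  is_subhypergroup I /\
  (forall r a : R, I a -> I (hmul r a) /\ I (hmul a r)).

Definition proper_hyperideal (R : hyperring) (I : set R) : Prop :=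
  is_hyperideal I /\ I <> [set: R].

Definition maximal_hyperideal (R : hyperring) (m : set R) : Prop :=
  proper_hyperideal m /\
  (forall I : set R, is_hyperideal I -> m `<=` I -> I = m \/ I = [set: R]).

(* Right hypermodules; even over a unital hyperring, the identity is not
   required to act trivially. *)
Record hypermodule (R : hyperring) := Hypermodule {
  hm_hypergroup :> canonicalHypergroup;
  hact : hm_hypergroup -> R -> hm_hypergroup;
  hactDl : forall m m' r,
    [set hact x r | x in hadd m m'] = hadd (hact m r) (hact m' r);
  hactDr : forall m r r',
    [set hact m x | x in hadd r r'] = hadd (hact m r) (hact m r');
  hactA : forall m r r', hact m (hmul r r') = hact (hact m r) r';
  hact0 : forall m, hact m hzero = hzero
}.

Arguments hact {_ _} _ _.

Definition is_subhypermodule (R : hyperring) (M : hypermodule R)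
    (S : set M) : Prop :=
  is_subhypergroup S /\ (forall (s : M) (r : R), S s -> S (hact s r)).

Definition simple_hypermodule (R : hyperring) (M : hypermodule R) : Prop :=
  (exists (m : M) (r : R), hact m r <> hzero) /\
  (forall S : set M, is_subhypermodule S -> S = [set hzero] \/ S = [set: M]).

Definition hAnn (R : hyperring) (M : hypermodule R) : set R :=
  [set r | forall m : M, hact m r = hzero].

Definition primitive_hyperideal (R : hyperring) (I : set R) : Prop :=
  proper_hyperideal I /\
  (exists M : hypermodule R, simple_hypermodule M /\ I = hAnn M).

(* Main.v *)
Require Import Defs.
From mathcomp Require Import all_boot.
From mathcomp Require Import boolp classical_sets.

(** By Zorn's lemma a maximal hyperideal [m] lies in a right hyperideal [N]
    maximal among those avoiding the identity. The quotient of the regular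
    right hypermodule by [N] is simple, and its annihilator is a proper
    hyperideal containing [m], hence equal to [m]. *)

Set Implicit Arguments.
Unset Strict Implicit.
Unset Printing Implicit Defensive.

Local Open Scope classical_set_scope.

(** * Canonical hypergroups: associativity on elements, subhypergroups *)

Section CanonicalHypergroups.
Variable H : canonicalHypergroup.
Implicit Types (a b c x : H) (S : set H).

Lemma hopp0 : hopp hzero = hzero :> H.
Proof. by apply/esym/hopp_unique; rewrite hadd0. Qed.

Lemma hoppK a : hopp (hopp a) = a.
Proof. by apply/esym/hopp_unique; rewrite haddC; exact: haddN. Qed.

(** [haddA] read on elements: rebracketing a sum replaces one intermediate element by another. With
    [haddA_rl], this avoids unfolding [set_hop] later. *)
Lemma haddA_lr a b c u x :
  hadd b c u -> hadd a u x -> exists2 v, hadd a b v & hadd v c x.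
Proof.
move=> bcu aux.
have : set_hop hadd [set a] (hadd b c) x by exists a => //; exists u.
by rewrite haddA => -[v abv [_ -> vcx]]; exists v.
Qed.

Lemma haddA_rl a b c v x :
  hadd a b v -> hadd v c x -> exists2 u, hadd b c u & hadd a u x.
Proof.
move=> abv vcx.
have : set_hop hadd (hadd a b) [set c] x by exists v => //; exists c.
by rewrite -haddA => -[_ -> [u bcu aux]]; exists u.
Qed.

Lemma subhypergroup0 S : is_subhypergroup S -> S hzero.
Proof. by move=> [[x Sx] SB]; apply: (SB x x Sx Sx); exact: haddN. Qed.

Lemma subhypergroupN S x : is_subhypergroup S -> S x -> S (hopp x).
Proof.
move=> hS Sx; apply: (hS.2 hzero x) => //; first exact: subhypergroup0.
by rewrite haddC hadd0.
Qed.

Lemma subhypergroupD S a b x :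
  is_subhypergroup S -> S a -> S b -> hadd a b x -> S x.
Proof.
move=> hS Sa Sb abx; apply: (hS.2 a (hopp b)) => //.
  exact: subhypergroupN.
by rewrite hoppK.
Qed.

End CanonicalHypergroups.

(** * Quotient of a canonical hypergroup by a subhypergroup *)

Section QuotientHypergroup.
Variables (H : canonicalHypergroup) (N : set H) (hN : is_subhypergroup N).
Implicit Types (a b c x : H).

(** Serves both as the set a + N and as the relation [coset a b], an equivalence by the next three
    lemmas. *)
Definition coset a : set H := \bigcup_(n in N) hadd a n.

Lemma coset_refl a : coset a a.
Proof. by exists hzero; [exact: subhypergroup0|rewrite hadd0]. Qed.

Lemma coset_sym a b : coset a b -> coset b a.
Proof.
move=> [n Nn anb]; exists (hopp n); first exact: subhypergroupN.
by have [] := hadd_reversible anb.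
Qed.

Lemma coset_trans a b c : coset a b -> coset b c -> coset a c.
Proof.
move=> [n Nn anb] [k Nk bkc]; have [u nku auc] := haddA_rl anb bkc.
by exists u => //; exact: subhypergroupD nku.
Qed.

Lemma coset_eq a b : coset a = coset b <-> coset a b.
Proof.
split=> [->|ab]; first exact: coset_refl.
apply/seteqP; split=> x; first exact/coset_trans/coset_sym.
exact: coset_trans.
Qed.

Lemma coset_haddl a a' b x :
  coset a a' -> hadd a' b x -> exists2 y, hadd a b y & coset y x.
Proof.
move=> [n Nn]; rewrite haddC => naa' a'bx.
have [y aby nyx] := haddA_rl naa' a'bx.
by exists y => //; exists n => //; rewrite haddC.
Qed.

(** Makes addition of cosets well defined; commutativity lets [coset_haddl] replace one summand at a
    time. *)
Lemma coset_hadd a a' b b' x : coset a a' -> coset b b' -> hadd a' b' x ->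
  exists2 y, hadd a b y & coset y x.
Proof.
move=> aa' bb' /(coset_haddl aa')[y]; rewrite haddC.
move=> /(coset_haddl bb')[z]; rewrite haddC => abz zy yx.
by exists z => //; exact: coset_trans yx.
Qed.

Lemma coset_hopp a b : coset a b -> coset (hopp a) (hopp b).
Proof.
move=> [n Nn anb]; apply: coset_sym; exists n => //.
(* Reversibility twice: b in a + n gives n in -a + b, then -a in -b + n. *)
have [+ _] := hadd_reversible anb.
by rewrite haddC => /hadd_reversible[].
Qed.

Lemma coset0 a : coset hzero a <-> N a.
Proof.
split=> [[n Nn]|Na]; first by rewrite haddC hadd0 => ->.
by exists a => //; rewrite haddC hadd0.
Qed.

Definition quot : Type := {A : set H | range coset A}.

Definition qpi a : quot := exist _ (coset a) (imageT coset a).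

Lemma qpi_eq a b : qpi a = qpi b <-> coset a b.
Proof.
rewrite -coset_eq; split=> [[]//|ab]; exact: eq_exist.
Qed.

Lemma qpi_eq0 a : qpi a = qpi hzero <-> N a.
Proof. by split=> [/esym/qpi_eq/coset0|/coset0/qpi_eq]. Qed.

Lemma qpi_surj (A : quot) : exists a, qpi a = A.
Proof. by case: A => A AP; have [a _ aA] := AP; exists a; exact: eq_exist. Qed.

Definition qrepr (A : quot) : H := projT1 (cid (qpi_surj A)).

Lemma qreprK A : qpi (qrepr A) = A.
Proof. exact: projT2 (cid (qpi_surj A)). Qed.

(** Computed on chosen representatives; [qadd_qpi] shows that the choice is immaterial. *)
Definition qadd (A B : quot) : set quot := qpi @` hadd (qrepr A) (qrepr B).

Definition qopp (A : quot) : quot := qpi (hopp (qrepr A)).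

Lemma qadd_qpi a b : qadd (qpi a) (qpi b) = qpi @` hadd a b.
Proof.
have ra := (qpi_eq _ _).1 (qreprK (qpi a)).
have rb := (qpi_eq _ _).1 (qreprK (qpi b)).
apply/seteqP; split=> _ [x abx <-].
  have [y aby /qpi_eq yx] := coset_hadd (coset_sym ra) (coset_sym rb) abx.
  by exists y.
have [y aby /qpi_eq yx] := coset_hadd ra rb abx.
by exists y.
Qed.

Lemma qopp_qpi a : qopp (qpi a) = qpi (hopp a).
Proof. by apply/qpi_eq/coset_hopp/qpi_eq; rewrite qreprK. Qed.

Lemma qadd_nonempty A B : qadd A B !=set0.
Proof.
by have [x abx] := hadd_nonempty (qrepr A) (qrepr B); exists (qpi x), x.
Qed.

Lemma qaddC A B : qadd A B = qadd B A.
Proof. by rewrite /qadd haddC. Qed.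

Lemma qaddA A B C :
  set_hop qadd [set A] (qadd B C) = set_hop qadd (qadd A B) [set C].
Proof.
have [a <-] := qpi_surj A; have [b <-] := qpi_surj B; have [c <-] := qpi_surj C.
apply/seteqP; split=> X.
  case=> _ -> [_ /[!qadd_qpi] -[u bcu <-] /[!qadd_qpi] -[x aux <-]].
  have [v abv vcx] := haddA_lr bcu aux.
  by exists (qpi v); [exists v|exists (qpi c) => //; rewrite qadd_qpi; exists x].
case=> _ /[!qadd_qpi] -[v abv <-] [_ -> /[!qadd_qpi] -[x vcx <-]].
have [u bcu aux] := haddA_rl abv vcx.
by exists (qpi a) => //; exists (qpi u); [exists u|rewrite qadd_qpi; exists x].
Qed.

Lemma qadd0 A : qadd A (qpi hzero) = [set A].
Proof. by have [a <-] := qpi_surj A; rewrite qadd_qpi hadd0 image_set1. Qed.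

Lemma qaddN A : qadd A (qopp A) (qpi hzero).
Proof.
have [a <-] := qpi_surj A; rewrite qopp_qpi qadd_qpi.
by exists hzero => //; exact: haddN.
Qed.

Lemma qopp_unique A B : qadd A B (qpi hzero) -> B = qopp A.
Proof.
have [a <-] := qpi_surj A; have [b <-] := qpi_surj B.
rewrite qadd_qpi qopp_qpi => -[c abc /qpi_eq0 Nc].
apply/esym/qpi_eq; exists c => //.
by have [] := hadd_reversible abc.
Qed.

Lemma qadd_reversible A B C :
  qadd B C A -> qadd (qopp B) A C /\ qadd A (qopp C) B.
Proof.
have [b <-] := qpi_surj B; have [c <-] := qpi_surj C.
rewrite qadd_qpi => -[a /hadd_reversible[bac acb] <-].
by rewrite !qopp_qpi !qadd_qpi; split; [exists c|exists b].
Qed.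

Definition quot_hypergroup : canonicalHypergroup :=
  CanonicalHypergroup qadd_nonempty qaddC qaddA qadd0 qaddN qopp_unique
    qadd_reversible.

End QuotientHypergroup.

(** * Annihilators, and Zorn's lemma for subhypermodules *)

Section Hypermodules.
Variables (R : hyperring) (M : hypermodule R).
Implicit Types (u v : M) (r : R) (S : set M).

Lemma hact0r r : hact (hzero : M) r = hzero.
(* Only m0 = 0 is an axiom; here 0r = (00)r = 0(0r), where 0r = 0 in the hyperring, so the value is
   00 = 0. *)
Proof. by rewrite -[in LHS](hact0 (hzero : M)) -hactA hmul0r hact0. Qed.

Lemma hactrN u r : hact u (hopp r) = hopp (hact u r).
Proof.
apply: hopp_unique; rewrite -hactDr; exists hzero; first exact: haddN.
exact: hact0.
Qed.

Lemma hAnn_hyperideal : is_hyperideal (hAnn M).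
Proof.
split; [split|].
- by exists hzero => u; exact: hact0.
- move=> r s ur us t rst u.
  (* For t in r - s, ut lies in ur - us = 0 - 0, which is the singleton of 0. *)
  have : hadd (hact u r) (hact u (hopp s)) (hact u t).
    by rewrite -hactDr; exists t.
  by rewrite hactrN ur us hopp0 hadd0.
- by move=> r s us; split=> u; rewrite hactA us ?hact0r.
Qed.

(** Zorn's lemma applies because being a subhypermodule and avoiding [u] both survive unions of
    chains. *)
Lemma exists_maximal_avoiding S u : is_subhypermodule S -> ~ S u ->
  exists N, [/\ is_subhypermodule N, S `<=` N, ~ N u &
    forall T, is_subhypermodule T -> N `<=` T -> ~ T u -> T = N].
Proof.
move=> hS Su.
(* Keeping [S] as a separate union summand makes the empty chain harmless. *)
pose P A := is_subhypermodule (S `|` A) /\ ~ (S `|` A) u.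
have [|A [[hSA SAu] maxA]] := @Zorn_bigcup _ P; last first.
  exists (S `|` A); split=> // T hT SAT Tu.
  have ST : S `|` T = T.
    by apply/setUidPr => x Sx; apply: SAT; left.
  (* If [T] is not inside [A], it strictly contains [A] and, being equal to S ∪ T, satisfies [P],
     against the maximality of [A]. *)
  have [TA|nTA] := pselect (T `<=` A).
    by apply/seteqP; split=> // x /TA; right.
  case: (maxA T); last by rewrite /P ST.
  by split=> // x Ax; apply: SAT; right.
move=> F FP totF.
(* Each point of the union already lies in a single subhypermodule S ∪ B, with B empty for points of
   [S]. *)
have FPx x : (S `|` \bigcup_(X in F) X) x ->
    exists2 B, (S `|` B) x & is_subhypermodule (S `|` B) /\
      (S `|` B `<=` S `|` \bigcup_(X in F) X).
  move=> [Sx|[X FX Xx]].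
    by exists set0; rewrite setU0 //; split=> // y; left.
  exists X; [by right|split; first exact: (FP X FX).1].
  by move=> y [Sy|Xy]; [left|right; exists X].
split; last by move=> [//|[X FX Xu]]; apply: (FP X FX).2; right.
split; [split|].
- by exists hzero; left; exact: (subhypergroup0 hS.1).
- have closed B x y : is_subhypermodule (S `|` B) ->
      (S `|` B `<=` S `|` \bigcup_(X in F) X) ->
      (S `|` B) x -> (S `|` B) y ->
      hadd x (hopp y) `<=` S `|` \bigcup_(X in F) X.
    by move=> [[_ hB] _] BF Bx By z /(hB _ _ Bx By)/BF.
  have sub X : F X -> S `|` X `<=` S `|` \bigcup_(X in F) X.
    by move=> FX z [Sz|Xz]; [left|right; exists X].
  (* In each case both points lie in one S ∪ B; when they come from [X] and [Y], B is the larger of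
     the two. *)
  move=> x y [Sx|[X FX Xx]] [Sy|[Y FY Yy]].
  + by apply: (closed set0); rewrite ?setU0 // => z; left.
  + by apply: (closed Y); [exact: (FP Y FY).1|exact: sub|left|right].
  + by apply: (closed X); [exact: (FP X FX).1|exact: sub|right|left].
  + have [XY|YX] := totF X Y FX FY.
      by apply: (closed Y); [exact: (FP Y FY).1|exact: sub|right; exact: XY|right].
    by apply: (closed X); [exact: (FP X FX).1|exact: sub|right|right; exact: YX].
- by move=> s r /FPx[B Bs [[_ hB]]]; apply; exact: hB.
Qed.

End Hypermodules.

(** * Quotient hypermodules *)

Section QuotientHypermodule.
Variables (R : hyperring) (M : hypermodule R) (N : set M).
Hypothesis hN : is_subhypermodule N.

Local Notation Q := (quot_hypergroup hN.1).
Local Notation pi := (@qpi M N : M -> Q).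

Definition qact (A : Q) (r : R) : Q := pi (hact (qrepr A) r).

(** Independence of the representative: if u lies in u' + n with n in [N], then ur lies in u'r + nr,
    and nr is in [N]. *)
Lemma qact_qpi u r : qact (pi u) r = pi (hact u r).
Proof.
have [n Nn] := (qpi_eq hN.1 _ _).1 (qreprK (pi u)).
move=> unx; apply/(qpi_eq hN.1); exists (hact n r); first exact: hN.2.
by rewrite -hactDl; exists u.
Qed.

Lemma qactDl (A B : Q) r :
  [set qact X r | X in hadd A B] = hadd (qact A r) (qact B r).
Proof.
have [a <-] := qpi_surj A; have [b <-] := qpi_surj B.
rewrite !qact_qpi /= !(qadd_qpi hN.1) -hactDl.
rewrite !image_comp; apply: eq_imagel => x _ /=; exact: qact_qpi.
Qed.

Lemma qactDr (A : Q) r s :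
  [set qact A x | x in hadd r s] = hadd (qact A r) (qact A s).
Proof.
have [a <-] := qpi_surj A.
rewrite !qact_qpi /= (qadd_qpi hN.1) -hactDr.
rewrite image_comp; apply: eq_imagel => x _ /=; exact: qact_qpi.
Qed.

Lemma qactA (A : Q) r s : qact A (hmul r s) = qact (qact A r) s.
Proof. by have [a <-] := qpi_surj A; rewrite !qact_qpi hactA. Qed.

Lemma qact0 (A : Q) : qact A hzero = hzero.
Proof. by have [a <-] := qpi_surj A; rewrite qact_qpi hact0. Qed.

Definition quot_hypermodule : hypermodule R :=
  Hypermodule qactDl qactDr qactA qact0.

(** Lets a maximality property of [N] be tested against subhypermodules of the quotient. *)
Lemma qpi_preimage_subhypermodule (S : set quot_hypermodule) :
  is_subhypermodule S -> is_subhypermodule (pi @^-1` S).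
Proof.
move=> [hS SR]; split; [split|].
- by exists hzero; exact: (subhypergroup0 hS).
- move=> x y Sx Sy z xyz; apply: (hS.2 _ _ Sx Sy).
  by rewrite /= (qopp_qpi hN.1) (qadd_qpi hN.1); exists z.
- by move=> s r Ss; rewrite /preimage/= -qact_qpi; exact: SR.
Qed.

End QuotientHypermodule.

(** * The regular right hypermodule, whose subhypermodules are the right hyperideals, and its simple
    quotients *)

Definition regular_hypermodule (R : hyperring) : hypermodule R :=
  Hypermodule (fun a b c => hmulDl a b c) (fun a b c => hmulDr a b c)
    (fun a b c => hmulA a b c) (fun a => hmulr0 a).

(** The action is nonzero since ee = e is outside [N]. The preimage of [S] contains [N]: if it
    contains [e], then a = ea makes it everything; otherwise it equals [N], so [S] is zero. *)
Lemma quot_regular_simple (R : hyperring) (e : R)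
    (N : set (regular_hypermodule R)) (hN : is_subhypermodule N) :
  (forall a : R, hmul a e = a /\ hmul e a = a) -> ~ N e ->
  (forall T : set (regular_hypermodule R),
    is_subhypermodule T -> N `<=` T -> ~ T e -> T = N) ->
  simple_hypermodule (quot_hypermodule hN).
Proof.
move=> eP Ne maxN; split.
  exists (qpi N e), e; rewrite /= qact_qpi /= (eP e).1.
  by move/(qpi_eq0 hN.1).
move=> S hS; have hT := qpi_preimage_subhypermodule hS.
have NT : N `<=` qpi N @^-1` S.
  move=> x /(qpi_eq0 hN.1) x0; rewrite /preimage/= x0.
  exact: (subhypergroup0 hS.1).
have [Te|Te] := pselect (S (qpi N e)).
  right; apply/seteqP; split=> // A _; have [a <-] := qpi_surj A.
  by have := hT.2 e a Te; rewrite /= (eP a).2.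
left; apply/seteqP; split=> [A SA|_ ->]; last exact: (subhypergroup0 hS.1).
have [a aA] := qpi_surj A; rewrite -aA; apply/(qpi_eq0 hN.1).
by rewrite -(maxN _ hT NT Te) /preimage/= aA.
Qed.

Lemma hAnn_proper (R : hyperring) (M : hypermodule R) :
  unital R -> simple_hypermodule M -> proper_hyperideal (hAnn M).
Proof.
move=> [e eP] [[u [r ur0]] _]; split; first exact: hAnn_hyperideal.
move=> annT; apply: ur0; suff : hAnn M r by apply.
by rewrite annT.
Qed.

Theorem proposition3p7 (R : hyperring) (unitR : unital R) (m : set R)
  (maxm : maximal_hyperideal m) : primitive_hyperideal m.
Proof.
have [[hm mT] maxm'] := maxm; split=> //.
have [e eP] := unitR.
have me : ~ m e.
  move=> me; apply: mT; apply/seteqP; split=> // r _.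
  by rewrite -(eP r).1; have [] := hm.2 r e me.
have hmM : @is_subhypermodule R (regular_hypermodule R) m.
  by split; [exact: hm.1|move=> s r /(hm.2 r)[]].
have [N [hN mN Ne maxN]] := exists_maximal_avoiding hmM me.
have simpleM := quot_regular_simple hN eP Ne maxN.
exists (quot_hypermodule hN); split=> //.
have [hA AT] := hAnn_proper unitR simpleM.
(* Since the annihilator is proper, maximality of [m] leaves only its inclusion in the annihilator:
   for x in [m], the product ax is in [m], hence in [N], so the class of a is killed by x. *)
have [x mx A|//|//] := maxm' _ hA.
have [a <-] := qpi_surj A; rewrite /= qact_qpi; apply/(qpi_eq0 hN.1).
by apply: mN; have [] := hm.2 a x mx.
Qed.
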